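(* Let $X = X_1\sqcup\dots\sqcup X_m$ and $Y = Y_1\sqcup\dots\sqcup Y_m$ be finite sets, partitioned into parts with $|X_k|\le|Y_k|$ for all $k\in[m]$. Let $\mathcal{S}$ be the set of injections $\sigma: X\to Y$ with $\sigma(X_k)\subset Y_k$ for all $k\in[m]$, and let $\Omega$ be the uniform probability space on $\mathcal{S}$. Let $B_i = \Omega(T_i,U_i,\tau_i)$, $i\in[N]$, be a family of canonical events in $\Omega$, and let $D$ be the graph on vertex set $[N]$ in which distinct $i,j$ are adjacent if and only if $B_i$ and $B_j$ $\mathcal{S}$-intersect. Then $D$ is a negative dependency graph for $B_1,\dots,B_N$.
   Context: For $T\subset X$, $U\subset Y$ and a bijection $\tau: T\to U$, the corresponding canonical event is $\Omega(T,U,\tau) = \{\sigma\in\mathcal{S}: \sigma(x) = \tau(x)\text{ for all }x\in T\}$; canonical events are understood together with their defining triple $(T,U,\tau)$. Two canonical events $\Omega(T_1,U_1,\tau_1)$ and $\Omega(T_2,U_2,\tau_2)$ $\mathcal{S}$-intersect if $T_1\cap T_2\ne\emptyset$ or $U_1\cap U_2\neq\emptyset$. A graph $D$ with vertex set $[N]$ is a negative dependency graph for events $B_1,\dots,B_N$ if for every $i\in[N]$ and every set $J\subset\{j: ij\notin E(D)\}$ it holds that $\mathbb{P}\left[B_i \mid \bigwedge_{j\in J}\overline{B_j}\right]\le\mathbb{P}[B_i]$, where the inequality is only required when the conditioning event has positive probability. *)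

(* Defs.v *)
From HB Require Import structures.
From mathcomp Require Import all_boot all_order all_algebra.

Set Implicit Arguments.
Unset Strict Implicit.
Unset Printing Implicit Defensive.

Import Order.TTheory GRing.Theory Num.Theory.
Local Open Scope ring_scope.

(* Parts may be empty, unlike the blocks of [partition] in finset. *)
Definition disjoint_parts (Z : finType) (m : nat) (P : 'I_m -> {set Z}) : Prop :=
  (forall k l : 'I_m, k != l -> [disjoint P k & P l]) /\
  \bigcup_(k < m) P k = [set: Z].

Section PartInjections.
Variables (X Y : finType) (m : nat).
Variables (XP : 'I_m -> {set X}) (YP : 'I_m -> {set Y}).

Record part_injection := PartInjection {
  injection_fun :> {ffun X -> Y};
  _ : injectiveb injection_fun
      && [forall k : 'I_m, injection_fun @: XP k \subset YP k]
}.

HB.instance Definition _ := [isSub for injection_fun].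
HB.instance Definition _ := [Finite of part_injection by <:].

End PartInjections.

Record canonical_triple (X Y : finType) := CanonicalTriple {
  cT : {set X};
  cU : {set Y};
  ctau : {x : X | x \in cT} -> {y : Y | y \in cU};
  ctau_bij : bijective ctau
}.

Definition canonical_event (X Y : finType) (m : nat)
    (XP : 'I_m -> {set X}) (YP : 'I_m -> {set Y})
    (c : canonical_triple X Y) : {set part_injection XP YP} :=
  [set s : part_injection XP YP |
    [forall x : {x : X | x \in cT c}, s (val x) == val (ctau x)]].

Definition S_intersect (X Y : finType) (c1 c2 : canonical_triple X Y) : bool :=
  (cT c1 :&: cT c2 != set0) || (cU c1 :&: cU c2 != set0).

Record sgraph (V : finType) := SGraph {
  adj : rel V;
  adj_sym : symmetric adj;
  adj_irrefl : irreflexive adj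
}.

Section IntersectGraph.
Variables (X Y : finType) (N : nat) (C : 'I_N -> canonical_triple X Y).

Definition intersect_adj : rel 'I_N :=
  fun i j => (i != j) && S_intersect (C i) (C j).

Lemma intersect_adj_sym : symmetric intersect_adj.
Proof.
by move=> i j; rewrite /intersect_adj /S_intersect eq_sym setIC [cU _ :&: _]setIC.
Qed.

Lemma intersect_adj_irrefl : irreflexive intersect_adj.
Proof. by move=> i; rewrite /intersect_adj eqxx. Qed.

Definition intersect_graph : sgraph 'I_N :=
  SGraph intersect_adj_sym intersect_adj_irrefl.

End IntersectGraph.

Definition uniform_prob (R : realFieldType) (W : finType) (A : {set W}) : R :=
  #|A|%:R / #|W|%:R.

Definition cond_prob (R : realFieldType) (W : finType) (P : {set W} -> R)
    (A B : {set W}) : R :=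
  P (A :&: B) / P B.

(* J may contain i itself, since i is never adjacent to i. *)
Definition negative_dependency_graph (R : realFieldType) (W : finType)
    (P : {set W} -> R) (N : nat) (B : 'I_N -> {set W}) (D : sgraph 'I_N) : Prop :=
  forall (i : 'I_N) (J : {set 'I_N}),
    J \subset [set j : 'I_N | ~~ adj D i j] ->
    0 < P (\bigcap_(j in J) ~: B j) ->
    cond_prob P (B i) (\bigcap_(j in J) ~: B j) <= P (B i).

(* Main.v *)
(* Write [B] for the event of index [i], with domain [T], and [A] for the
   conditioning event. Given an injection [s], let [p] be a permutation of [Y],
   depending only on [s] restricted to [T], that carries the prescribed values
   on [T] to those of [s], preserves the parts of [Y] and moves no other points.
   If [r] is in both [B] and [A], then [p \o r] is still in [A]: an event
   disjoint from [B] in domain and range prescribes values fixed by [p].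
   Moreover [p^-1 \o s] is in [B]. Since [p] can be recovered from [p \o r],
   which agrees with [s] on [T], the map [(r, s) |-> (p^-1 \o s, p \o r)] is
   injective, whence [#|B :&: A| * #|S| <= #|B| * #|A|]. *)
Require Import Defs.
From mathcomp Require Import all_boot all_order all_algebra all_fingroup.

Set Implicit Arguments.
Unset Strict Implicit.
Unset Printing Implicit Defensive.

Section Align.
Variables (X : eqType) (Y : finType).
Implicit Types (a b : X -> Y) (t : seq X).

(** Each transposition moves the current image of [a x] to [b x]; products of permutations act from
    left to right. *)
Fixpoint align_perm a b t : {perm Y} :=
  if t is x :: t' then
    (align_perm a b t' * tperm (align_perm a b t' (a x)) (b x))%g
  else 1%g.

Lemma eq_align_perm a b b' t :
  {in t, b =1 b'} -> align_perm a b t = align_perm a b' t.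
Proof.
elim: t => //= x t IHt eqb; rewrite IHt ?eqb ?mem_head // => y ty.
by rewrite eqb // inE ty orbT.
Qed.

(** For [y] in the tail, injectivity keeps [b y] away from both points swapped for the head [x]. *)
Lemma align_permE a b t : injective a -> injective b -> uniq t ->
  {in t, forall x, align_perm a b t (a x) = b x}.
Proof.
move=> inj_a inj_b; elim: t => //= x t IHt /andP[xNt uniq_t] y.
rewrite inE permM => /predU1P[-> | ty]; first by rewrite tpermL.
have neq_xy : x != y by apply: contraNneq xNt => ->.
rewrite -(IHt uniq_t y ty) tpermD // ?(inj_eq perm_inj) ?(inj_eq inj_a) //.
by rewrite IHt // (inj_eq inj_b).
Qed.

Lemma align_perm_fix a b t y :
  y \notin map a t -> y \notin map b t -> align_perm a b t y = y.
Proof.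
elim: t => [|x t IHt] /=; first by rewrite perm1.
rewrite !inE !negb_or => /andP[yNa yNat] /andP[yNb yNbt].
have fix_y := IHt yNat yNbt.
rewrite permM fix_y tpermD // 1?eq_sym //.
(* As [y] is already fixed, it is the current image of [a x] only if [y = a x]. *)
by rewrite -{1}fix_y (inj_eq perm_inj).
Qed.

(** Each step swaps two points on the same side of [P]: by induction the current image of [a x] is
    in [P] exactly when [a x] is. *)
Lemma align_perm_stable a b t (P : {set Y}) y :
  (forall x, (a x \in P) = (b x \in P)) ->
  (align_perm a b t y \in P) = (y \in P).
Proof.
move=> abP; elim: t y => [|x t IHt] y /=; first by rewrite perm1.
rewrite permM; case: tpermP => [eq_y | eq_y | _ _]; last exact: IHt.
  by rewrite -abP -(IHt y) eq_y IHt.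
by rewrite IHt abP -eq_y IHt.
Qed.

End Align.

Section PartInjectionTheory.
Variables (X Y : finType) (m : nat).
Variables (XP : 'I_m -> {set X}) (YP : 'I_m -> {set Y}).
Implicit Types (s r : part_injection XP YP) (p : {perm Y}).

Lemma part_injection_inj s : injective s.
Proof. by case: s => f /= /andP[/injectiveP]. Qed.

Lemma part_injection_mem s k x : x \in XP k -> s x \in YP k.
Proof.
case: s => f /= /andP[_ /forallP/(_ k)/subsetP sub] xk.
by apply: sub; apply: imset_f.
Qed.

Lemma part_injection_ext s r : s =1 r -> s = r.
Proof. by move=> eq_sr; apply: val_inj; apply/ffunP. Qed.

(** Both values lie in the part of [Y] matched to the part of [X] that contains [x], and the parts
    of [Y] are disjoint. *)
Lemma part_injection_same_part (hX : disjoint_parts XP)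
    (hY : disjoint_parts YP) s r k x :
  (s x \in YP k) = (r x \in YP k).
Proof.
have : x \in \bigcup_(l < m) XP l by rewrite hX.2 inE.
case/bigcupP=> l _ xl; have [<- | neq_lk] := eqVneq l k.
  by rewrite !part_injection_mem.
have dis := hY.1 l k neq_lk.
by rewrite !(disjointFr dis) // part_injection_mem.
Qed.

(* [insubd] yields the junk value [s] unless [p] preserves the parts. *)
Definition perm_comp p s : part_injection XP YP :=
  insubd s [ffun x => p (s x)].

Lemma perm_compE p s :
  (forall k y, (p y \in YP k) = (y \in YP k)) ->
  forall x, perm_comp p s x = p (s x).
Proof.
move=> stable x; rewrite /perm_comp /insubd insubT /= ?ffunE //.
apply/andP; split.
  by apply/injectiveP=> y z; rewrite !ffunE => /perm_inj/part_injection_inj.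
apply/forallP=> k; apply/subsetP=> _ /imsetP[y yk ->].
by rewrite ffunE stable part_injection_mem.
Qed.

Lemma canonical_eventP (c : canonical_triple X Y) s :
  reflect (forall x (xT : x \in cT c), s x = val (ctau (exist _ x xT)))
          (s \in canonical_event XP YP c).
Proof.
rewrite inE; apply: (iffP forallP) => [h x xT | h [x xT]].
  exact/eqP/(h (exist _ x xT)).
exact/eqP/h.
Qed.

Lemma canonical_event_mem (c : canonical_triple X Y) s x :
  s \in canonical_event XP YP c -> x \in cT c -> s x \in cU c.
Proof. by move=> /canonical_eventP sB xT; rewrite (sB x xT); apply: valP. Qed.

Section Exchange.
Hypotheses (hX : disjoint_parts XP) (hY : disjoint_parts YP).
Variables (c : canonical_triple X Y) (s0 : part_injection XP YP).
Hypothesis s0B : s0 \in canonical_event XP YP c.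

(** The total injection [s0] stands in for [ctau], which is defined only on a subtype; all members
    of the event agree on [cT c]. *)
Let p s := align_perm s0 s (enum (cT c)).

Let p_stable s k y : (p s y \in YP k) = (y \in YP k).
Proof. by apply: align_perm_stable => x; apply: part_injection_same_part. Qed.

Let pV_stable s k y : ((p s)^-1%g y \in YP k) = (y \in YP k).
Proof. by rewrite -(p_stable s) permKV. Qed.

Let p_s0 s x : x \in cT c -> p s (s0 x) = s x.
Proof.
move=> xT; apply: align_permE; rewrite ?enum_uniq ?mem_enum //;
  exact: part_injection_inj.
Qed.

Let event_agree r x :
  r \in canonical_event XP YP c -> x \in cT c -> r x = s0 x.
Proof.
by move=> /canonical_eventP rB xT; rewrite rB (canonical_eventP _ _ s0B).
Qed.

Lemma exchange_avoid (d : canonical_triple X Y) r s :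
  ~~ S_intersect c d -> r \in canonical_event XP YP c ->
  perm_comp (p s) r \in canonical_event XP YP d ->
  r \in canonical_event XP YP d.
Proof.
rewrite negb_or !negbK => /andP[/eqP disT /eqP disU] rB prB.
apply/canonical_eventP=> x xT.
have prx := perm_compE r (p_stable s) x.
rewrite -(canonical_eventP _ _ prB x xT).
have xNT : x \notin cT c.
  by apply/negP=> xTc; have := in_set0 x; rewrite -disT inE xTc xT.
suffices fix_prx : p s (perm_comp (p s) r x) = perm_comp (p s) r x.
  by apply: (@perm_inj _ (p s)); rewrite fix_prx prx.
(* A value in [cU d] is not a value of [s0] on [cT c], by disjointness of the ranges. Nor is it one
   of [s] there: [p s (r x) = s z = p s (r z)] would put [x = z] in [cT c]. *)
apply: align_perm_fix; apply/mapP=> -[z]; rewrite mem_enum => zT eq_z.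
  have := in_set0 (s0 z); rewrite -disU inE (canonical_event_mem s0B zT) -eq_z.
  by rewrite (canonical_event_mem prB xT).
move: eq_z; rewrite prx -(p_s0 s zT) -(event_agree rB zT).
by move=> /perm_inj/part_injection_inj eq_xz; rewrite eq_xz zT in xNT.
Qed.

Lemma exchange_card (A : {set part_injection XP YP}) :
  (forall r s, r \in canonical_event XP YP c :&: A -> perm_comp (p s) r \in A) ->
  #|canonical_event XP YP c :&: A| * #|{: part_injection XP YP}|
    <= #|canonical_event XP YP c| * #|A|.
Proof.
move=> pA; rewrite -[#|{: _}|]cardsT -!cardsX.
pose phi (u : part_injection XP YP * part_injection XP YP) :=
  (perm_comp (p u.2)^-1%g u.2, perm_comp (p u.2) u.1).
set E := setX _ _; suffices inj_phi : {in E &, injective phi}.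
  rewrite -(card_in_imset inj_phi); apply/subset_leq_card/subsetP.
  move=> _ /imsetP[[r s] /setXP[rBA _] ->]; apply/setXP; split; last exact: pA.
  apply/canonical_eventP=> x xT /=.
  rewrite (perm_compE _ (pV_stable s)) -(p_s0 s xT) permK.
  exact: (canonical_eventP _ _ s0B).
move=> [r s] [r' s'] /setXP[/setIP[rB _] _] /setXP[/setIP[rB' _] _].
case=> /= eq1 eq2.
have eq_p : p s = p s'.
  apply: eq_align_perm => x; rewrite mem_enum => xT.
  rewrite -(p_s0 s xT) -(p_s0 s' xT) -{1}(event_agree rB xT).
  by rewrite -(event_agree rB' xT) -!(perm_compE _ (p_stable _)) eq2.
congr (_, _); apply: part_injection_ext => x.
  apply: (@perm_inj _ (p s)).
  by rewrite {2}eq_p -!(perm_compE _ (p_stable _)) eq2.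
apply: (@perm_inj _ (p s)^-1%g).
by rewrite {2}eq_p -!(perm_compE _ (pV_stable _)) eq1.
Qed.

End Exchange.
End PartInjectionTheory.

Import Order.TTheory GRing.Theory Num.Theory.

Lemma cond_prob_uniform_le (R : realFieldType) (W : finType) (A B : {set W}) :
  #|A :&: B| * #|W| <= #|A| * #|B| ->
  (0 < uniform_prob R B)%R ->
  (cond_prob (@uniform_prob R W) A B <= uniform_prob R A)%R.
Proof.
move=> le_card B_gt0; rewrite /cond_prob ler_pdivrMr //.
have W_gt0 : (0 < #|W|%:R :> R)%R.
  (* Were [W] empty, the convention [0^-1 = 0] would give [B] probability 0. *)
  rewrite ltr0n lt0n; apply: contraTneq B_gt0 => W0.
  by rewrite /uniform_prob W0 invr0 mulr0 ltxx.
rewrite /uniform_prob ler_pdivrMr // -mulrA divfK ?gt_eqF // mulrAC.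
by rewrite ler_pdivlMr // -!natrM ler_nat.
Qed.

Theorem theorem2p2 (R : realFieldType) (X Y : finType) (m : nat)
    (XP : 'I_m -> {set X}) (YP : 'I_m -> {set Y})
    (hX : disjoint_parts XP) (hY : disjoint_parts YP)
    (hXY : forall k : 'I_m, #|XP k| <= #|YP k|)
    (N : nat) (C : 'I_N -> canonical_triple X Y) :
  negative_dependency_graph
    (@uniform_prob R (part_injection XP YP))
    (fun i : 'I_N => canonical_event XP YP (C i))
    (intersect_graph C).
Proof.
move=> i J /subsetP subJ A_gt0; apply: cond_prob_uniform_le => //.
set A := \bigcap_(j in J) _.
have [-> | [s0 /setIP[s0B s0A]]] :=
  set_0Vmem (canonical_event XP YP (C i) :&: A); first by rewrite cards0.
apply: (exchange_card hX hY s0B) => r s /setIP[rB /bigcapP rA].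
apply/bigcapP=> j jJ; have := rA j jJ; rewrite !in_setC; apply: contra.
apply: (exchange_avoid hX hY s0B) => //.
(* If [i] were in [J], then [A] would be disjoint from the event of [i], yet [s0] lies in both. *)
have neq_ij : i != j.
  apply: contraTneq s0A => eq_ij; apply/bigcapP=> /(_ j jJ).
  by rewrite in_setC -eq_ij s0B.
by have := subJ j jJ; rewrite inE /= /intersect_adj neq_ij.
Qed.
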